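(* Fix a $Y$-mesh $P$ of type $S=\{a,b,c,d\}$, where $S$ is a $Y$-pin, and for $r\in\mathbb{Z}^2$ let $$y_r=y_r(P)=-[P_{r+a},P_{r+c},P_{r+b},P_{r+d}].$$ Then $$y_{r+a+b}\,y_{r+c+d}=\frac{(1+y_{r+a+c})(1+y_{r+b+d})}{(1+y_{r+a+d}^{-1})(1+y_{r+b+c}^{-1})}\qquad(\ast)$$ for all $r\in\mathbb{Z}^2$. Moreover, there exists a quiver $Q_S$ and a sequence of mutations so that the $y$-variables transform according to $(\ast)$.
   Context: $Y$-pin: a set $S=\{a,b,c,d\}$ of four distinct points of $\mathbb{Z}^2$, with coordinates $a=(a_1,a_2)$ etc., labelled so that $a_2\le b_2<c_2\le d_2$, and such that the vectors $b-a,\ c-a,\ d-a$ generate all of $\mathbb{Z}^2$. $Y$-mesh: for a $Y$-pin $S=\{a,b,c,d\}$ and an integer $D\ge 2$, a $Y$-mesh of type $S$ and dimension $D$ is a grid of points $P_r$ and lines $L_r$ in $\mathbb{RP}^D$, indexed by $r\in\mathbb{Z}^2$, which together span all of $\mathbb{RP}^D$ and such that for every $r\in\mathbb{Z}^2$: (i) $P_{r+a},P_{r+b},P_{r+c},P_{r+d}$ all lie on $L_r$ and are distinct; (ii) the lines $L_{r-a},L_{r-b},L_{r-c},L_{r-d}$ (all of which contain $P_r$) are distinct. Cross ratio: for four points of a projective line, identified with $\mathbb{RP}^1=\mathbb{R}\cup\{\infty\}$, $[x_1,x_2,x_3,x_4]=\frac{(x_1-x_2)(x_3-x_4)}{(x_2-x_3)(x_4-x_1)}$;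 it is invariant under projective transformations. Quivers and mutations: a quiver is a directed graph (multiple arrows allowed) without loops or oriented two-cycles. Infinite quivers are allowed provided they are locally finite, meaning each vertex is connected to only finitely many others. The mutation $\mu_v$ of a quiver $Q$ at a vertex $v$: for each pair of arrows $u\to v$ and $v\to w$ add an arrow $u\to w$; reverse all arrows incident to $v$; remove all oriented two-cycles. A $Y$-seed is a pair $(Q,\mathbf{y})$ where $\mathbf{y}=(y_v)$ is a collection of variables (the $y$-variables) indexed by the vertices of $Q$. Its mutation at $v$ is $(\mu_v(Q),\mathbf{y}')$ with $y_v'=y_v^{-1}$ and, for $u\ne v$, $y_u'=y_u\prod_{u\to v}(1+y_v)\left(\prod_{v\to u}(1+y_v^{-1})\right)^{-1}$, the products being over arrows of $Q$. Mutations at vertices not connected by an arrow commute, so one may also mutate simultaneously at a (possibly infinite) set of vertices no two of which are connected by an arrow. *)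

(* Defs.v *)
From HB Require Import structures.
From mathcomp Require Import all_boot all_order all_algebra.
From mathcomp Require Import boolp classical_sets functions cardinality fsbigop.
From mathcomp Require Import reals.
From mathcomp Require Import ring.
Set Implicit Arguments.
Unset Strict Implicit.
Unset Printing Implicit Defensive.
Import Order.TTheory GRing.Theory Num.Theory.
Local Open Scope ring_scope.

Notation Z2 := (int * int)%type.

Record Y_pin (a b c d : Z2) : Prop := YPin {
  pin_distinct : uniq [:: a; b; c; d];
  pin_order : [&& a.2 <= b.2, b.2 < c.2 & c.2 <= d.2];
  pin_gen : forall z : Z2, exists i j k : int,
    z = (b - a) *~ i + (c - a) *~ j + (d - a) *~ k }.

(** A point (resp. line) of RP^D is a subspace of R^(D+1) of dimension 1
    (resp. 2); a point lies on a line when it is a subspace of it. *)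
Section Projective.
Variables (R : realType) (D : nat).
Local Notation V := 'rV[R]_(D.+1).

Definition is_point (p : {vspace V}) : Prop := \dim p = 1%N.
Definition is_line (l : {vspace V}) : Prop := \dim l = 2%N.

(** Homogeneous coordinates on a line [l]: the point spanned by [u] has
    coordinate [coord X 0 u / coord X 1 u] in RP^1, which is infinite when the
    denominator vanishes. *)
Definition line_basis (l : {vspace V}) : 2.-tuple V :=
  [tuple (vbasis l)`_0; (vbasis l)`_1].

Definition bracket (X : 2.-tuple V) (u v : V) : R :=
  coord X ord0 u * coord X ord_max v - coord X ord0 v * coord X ord_max u.

Definition cross_ratio_of (X : 2.-tuple V) (u1 u2 u3 u4 : V) : R :=
  (bracket X u1 u2 * bracket X u3 u4) / (bracket X u2 u3 * bracket X u4 u1).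

(** Cross ratio of four points of the line [l]; see [cross_ratioE] for the
    independence of choices and [cross_ratio_affine] for the usual formula. *)
Definition cross_ratio (l p1 p2 p3 p4 : {vspace V}) : R :=
  cross_ratio_of (line_basis l) (vpick p1) (vpick p2) (vpick p3) (vpick p4).

Lemma line_basisP (l : {vspace V}) : is_line l -> basis_of l (line_basis l).
Proof.
move=> l2; suff E : line_basis l = vbasis l :> seq V by rewrite E vbasisP.
have sz : size (vbasis l) = 2%N by rewrite size_tuple l2.
by rewrite /=; move: sz; case: (tval (vbasis l)) => [|? [|? []]].
Qed.

Lemma coord2E (X : 2.-tuple V) (l : {vspace V}) (u : V) :
  basis_of l X -> u \in l ->
  u = coord X ord0 u *: X`_0 + coord X ord_max u *: X`_1.
Proof.
move=> bX ul; rewrite {1}(coord_basis bX ul) big_ord_recl big_ord1.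
by congr (_ + coord _ _ _ *: _); apply: val_inj.
Qed.

Lemma bracket_change (X Y : 2.-tuple V) (l : {vspace V}) (u v : V) :
  basis_of l Y -> u \in l -> v \in l ->
  bracket X u v = bracket X Y`_0 Y`_1 * bracket Y u v.
Proof.
move=> bY ul vl.
rewrite {1}/bracket {1 2}(coord2E bY ul) {1 2}(coord2E bY vl) !linearP !linearZ.
rewrite /bracket /=; ring.
Qed.

Lemma bracket_basis (X : 2.-tuple V) (l : {vspace V}) :
  basis_of l X -> bracket X X`_0 X`_1 = 1.
Proof.
move=> bX; have fX := basis_free bX.
have E i j : coord X i X`_(nat_of_ord j) = (i == j)%:R.
  by rewrite coord_free // eq_sym.
by rewrite /bracket !(E _ ord0, E _ ord_max) /= mulr1 mulr0 subr0.
Qed.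

Lemma bracketZ (X : 2.-tuple V) (s t : R) (u v : V) :
  bracket X (s *: u) (t *: v) = s * t * bracket X u v.
Proof. by rewrite /bracket !linearZ /=; ring. Qed.

(** The cross ratio may be computed in any basis of the line, from any
    representatives of the points. *)
Lemma cross_ratioE (l : {vspace V}) (X : 2.-tuple V) (u1 u2 u3 u4 : V) :
  is_line l -> basis_of l X ->
  u1 \in l -> u2 \in l -> u3 \in l -> u4 \in l ->
  u1 != 0 -> u2 != 0 -> u3 != 0 -> u4 != 0 ->
  cross_ratio l <[u1]> <[u2]> <[u3]> <[u4]> = cross_ratio_of X u1 u2 u3 u4.
Proof.
move=> l2 bX h1 h2 h3 h4 n1 n2 n3 n4.
have pickE (u : V) : u != 0 -> exists2 k, k != 0 & vpick <[u]>%VS = k *: u.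
  move=> n0; have /vlineP[k E] := memv_pick <[u]>%VS; exists k => //.
  apply/eqP => k0; have : vpick <[u]>%VS == 0 by rewrite E k0 scale0r.
  by rewrite vpick0 -dimv_eq0 dim_vline n0.
rewrite /cross_ratio /cross_ratio_of.
have [k1 k1n ->] := pickE _ n1; have [k2 k2n ->] := pickE _ n2.
have [k3 k3n ->] := pickE _ n3; have [k4 k4n ->] := pickE _ n4.
rewrite !bracketZ; have bB := line_basisP l2.
set e := bracket (line_basis l) X`_0 X`_1.
have en : e != 0.
  apply/eqP => e0; have := bracket_basis bB.
  have := basis_mem bB => mB.
  rewrite (bracket_change _ bX) ?mB ?mem_nth ?size_tuple // -/e e0 mul0r.
  by move/esym/eqP; rewrite oner_eq0.
have be u v : u \in l -> v \in l -> bracket (line_basis l) u v = e * bracket X u v.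
  exact: bracket_change.
rewrite !be //.
set A := bracket X u1 u2; set B := bracket X u3 u4.
set C := bracket X u2 u3; set G := bracket X u4 u1.
have -> : k1 * k2 * (e * A) * (k3 * k4 * (e * B)) =
  (k1 * k2 * k3 * k4 * e * e) * (A * B) by ring.
have -> : k2 * k3 * (e * C) * (k4 * k1 * (e * G)) =
  (k1 * k2 * k3 * k4 * e * e) * (C * G) by ring.
by rewrite -mulf_div divff ?mul1r // !mulf_neq0.
Qed.

Lemma cross_ratio_affine (l : {vspace V}) (e f : V) (x1 x2 x3 x4 : R) :
  is_line l -> basis_of l [tuple e; f] ->
  cross_ratio l <[x1 *: e + f]> <[x2 *: e + f]> <[x3 *: e + f]> <[x4 *: e + f]>
  = ((x1 - x2) * (x3 - x4)) / ((x2 - x3) * (x4 - x1)).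
Proof.
move=> l2 bX; have fX := basis_free bX.
have el : e \in l by apply: (basis_mem bX); rewrite inE eqxx.
have fl : f \in l by apply: (basis_mem bX); rewrite !inE eqxx orbT.
have E i j : coord [tuple e; f] i [tuple e; f]`_(nat_of_ord j) = (i == j)%:R.
  by rewrite coord_free // eq_sym.
have c0 x : coord [tuple e; f] ord0 (x *: e + f) = x.
  by rewrite linearP /= (E _ ord0) (E _ ord_max) /= mulr1 addr0.
have c1 x : coord [tuple e; f] ord_max (x *: e + f) = 1.
  by rewrite linearP /= (E _ ord0) (E _ ord_max) /= mulr0 add0r.
have inl x : x *: e + f \in l by rewrite memvD ?memvZ.
have nz x : x *: e + f != 0.
  by apply/eqP => h; have /eqP := c1 x; rewrite h linear0 eq_sym oner_eq0.
by rewrite (cross_ratioE l2 bX) // /cross_ratio_of /bracket !c0 !c1 !mulr1.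
Qed.

Record Y_mesh (a b c d : Z2) (P L : Z2 -> {vspace V}) : Prop := YMesh {
  mesh_point : forall r, is_point (P r);
  mesh_line : forall r, is_line (L r);
  mesh_span : forall W : {vspace V},
    (forall r, (P r <= W)%VS) -> (forall r, (L r <= W)%VS) -> W = fullv;
  mesh_incident : forall r : Z2,
    [&& (P (r + a)%R <= L r)%VS, (P (r + b)%R <= L r)%VS,
        (P (r + c)%R <= L r)%VS & (P (r + d)%R <= L r)%VS];
  mesh_points_distinct : forall r : Z2,
    uniq [:: P (r + a); P (r + b); P (r + c); P (r + d)];
  mesh_lines_distinct : forall r : Z2,
    uniq [:: L (r - a); L (r - b); L (r - c); L (r - d)] }.

Definition mesh_y (a b c d : Z2) (P L : Z2 -> {vspace V}) (r : Z2) : R :=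
  - cross_ratio (L r) (P (r + a)) (P (r + c)) (P (r + b)) (P (r + d)).

End Projective.

Definition Y_relation (F : fieldType) (a b c d : Z2) (y : Z2 -> F) : Prop :=
  forall r : Z2,
    y (r + a + b) * y (r + c + d) =
    ((1 + y (r + a + c)) * (1 + y (r + b + d))) /
    ((1 + (y (r + a + d))^-1) * (1 + (y (r + b + c))^-1)).

Section Quivers.
Local Open Scope classical_set_scope.
Variable V : choiceType.

(** [q u v] is the number of arrows from [u] to [v]. *)
Definition arrows := V -> V -> nat.

Record is_quiver (q : arrows) : Prop := IsQuiver {
  quiver_no_loop : forall u, q u u = 0%N;
  quiver_no_2cycle : forall u v, q u v = 0%N \/ q v u = 0%N;
  quiver_locally_finite : forall u,
    finite_set [set v | (0 < q u v + q v u)%N] }.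

Definition disconnected (q : arrows) (M : set V) : Prop :=
  forall u v, M u -> M v -> q u v = 0%N.

(** Simultaneous mutation at a set [M] of vertices, meant for [M] with
    [disconnected q M]; the mutation at a single vertex [v] is the case
    [M = [set v]]. The sums and products have finite support when [q] is
    locally finite, and the truncated subtraction removes the oriented
    2-cycles. *)
Definition paths_through (M : set V) (q : arrows) (u w : V) : nat :=
  \big[addn/0%N]_(v \in M) (q u v * q v w)%N.

Lemma paths_through1 (q : arrows) (u v w : V) :
  paths_through [set v] q u w = (q u v * q v w)%N.
Proof. exact: fsbig_set1. Qed.

Definition quiver_mut (M : set V) (q : arrows) : arrows := fun u w =>
  if `[< M u \/ M w >] then q w u
  else (q u w + paths_through M q u w - (q w u + paths_through M q w u))%N.

Definition y_mut (F : fieldType) (M : set V) (q : arrows) (y : V -> F) : V -> F :=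
  fun u =>
  if `[< M u >] then (y u)^-1
  else y u * (\big[*%R/1]_(v \in M) (1 + y v) ^+ q u v)
           * (\big[*%R/1]_(v \in M) (1 + (y v)^-1) ^+ q v u)^-1.

Definition Y_seed (F : fieldType) : Type := (arrows * (V -> F))%type.

Lemma y_mut1 (F : fieldType) (q : arrows) (y : V -> F) (u v : V) : u != v ->
  y_mut [set v] q y u =
  y u * (1 + y v) ^+ q u v * ((1 + (y v)^-1) ^+ q v u)^-1.
Proof.
by move=> /eqP uv; rewrite /y_mut asboolF // !fsbig_set1.
Qed.

Definition seed_mut (F : fieldType) (M : set V) (s : Y_seed F) : Y_seed F :=
  (quiver_mut M s.1, y_mut M s.1 s.2).

End Quivers.

(** Given [mu t : T -> T], an involutive move between the states at times [t]
    and [t + 1], and the state [x] at time 0, the state at time [t]. *)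
Section Evolution.
Variables (T : Type) (mu : int -> T -> T) (x : T).

Fixpoint forward (n : nat) : T :=
  if n is m.+1 then mu (Posz m) (forward m) else x.

Fixpoint backward (n : nat) : T :=
  if n is m.+1 then mu (- Posz m.+1) (backward m) else x.

Definition evolve (t : int) : T :=
  match t with Posz n => forward n | Negz n => backward n.+1 end.

End Evolution.

Definition quiver_at (V : choiceType) (Q : arrows V) (M : int -> set V) :
    int -> arrows V :=
  evolve (fun t => quiver_mut (M t)) Q.

Definition seed_at (V : choiceType) (F : fieldType) (s : Y_seed V F)
    (M : int -> set V) : int -> Y_seed V F :=
  evolve (fun t => seed_mut (M t)) s.

(** The mutations in the sequence only divide by nonzero elements. *)
Definition regular_seed (V : choiceType) (F : fieldType) (s : Y_seed V F)
    (M : int -> set V) : Prop :=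
  forall t v, M t v -> (seed_at s M t).2 v != 0 /\ 1 + (seed_at s M t).2 v != 0.

(** Mutations at [M t] (row [t] of Z^2) for all integers [t] realize the
    relation: [lab r] is the vertex carrying [y_r], and [y_r] is its y-variable
    at time [r.2], immediately before it is mutated. As the relation replaces
    [y_(r+a+b)] by [y_(r+c+d)], vertices are labelled by Z^2 modulo [c+d-a-b],
    so the y-variables of a seed are in bijection with any [(c+d-a-b).2]
    consecutive rows. The initial y-variables are arbitrary. *)
Record realizes_Y_relation (a b c d : Z2) (V : choiceType) (Q : arrows V)
    (M : int -> set V) (lab : Z2 -> V) : Prop := RealizesYRelation {
  lab_surj : forall v, exists r, lab r = v;
  lab_eq : forall r s,
    lab r = lab s <-> exists k : int, s - r = (c + d - a - b) *~ k;
  mutated_row : forall t v, M t v <-> exists2 r : Z2, r.2 = t & lab r = v;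
  mutated_disconnected : forall t, disconnected (quiver_at Q M t) (M t);
  y_transform : forall (F : fieldType) (y0 : V -> F),
    regular_seed (Q, y0) M ->
    Y_relation a b c d (fun r => (seed_at (Q, y0) M r.2).2 (lab r)) }.

(* Main.v *)
(* The relation. Fix r and write P_xyz for P_(r+x+y+z). The four points P_bcd,
   P_acd, P_abd, P_abc and the six lines L_(r+x+y) form a (possibly flat)
   tetrahedron, and L_(r+2a) cuts the face formed by L_(r+a+b), L_(r+a+c),
   L_(r+a+d). Menelaus' theorem on each of the four faces gives four identities
   between brackets on the six edges, whose product is the relation.

   The quiver. Put p = c+d-a-b, x1 = d-a, x2 = c-b, z1 = c-a, z2 = d-b, so that
   x1 + x2 = z1 + z2 = p and all these vectors point upwards. The vertices are
   the classes of Z^2 modulo p. The relation prescribes the arrows at each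
   vertex v at the time it is mutated: v -> v+z1, v+z2 and v+x1, v+x2 -> v.
   Undoing the later mutations determines the whole quiver; that it comes back
   to its translate after one row has been mutated rests on the symmetry
   h -> p - h of the sets [x1, x2] and [z1, z2]. *)
Require Import Defs.
From mathcomp Require Import all_boot all_order all_algebra.
From mathcomp Require Import boolp classical_sets functions cardinality fsbigop.
From mathcomp Require Import reals ring zify.
Set Implicit Arguments.
Unset Strict Implicit.
Unset Printing Implicit Defensive.
Import Order.TTheory GRing.Theory Num.Theory.
Local Open Scope ring_scope.

(** * The relation for Y-meshes *)

Section Line.
Variables (R : realType) (D : nat).
Implicit Types (l : {vspace 'rV[R]_(D.+1)}) (u v w : 'rV[R]_(D.+1)).

(** Cramer's rule: three vectors of a plane are dependent, with brackets as coefficients. *)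
Lemma bracket_plucker l u v w : is_line l -> u \in l -> v \in l -> w \in l ->
  bracket (line_basis l) u v *: w =
  bracket (line_basis l) w v *: u + bracket (line_basis l) u w *: v.
Proof.
move=> l2 ul vl wl; set X := line_basis l; have bX := line_basisP l2; rewrite -/X in bX.
rewrite [in LHS](coord2E bX wl) {2}(coord2E bX ul) {3}(coord2E bX vl) /bracket.
by rewrite !scalerDr !scalerA addrACA -!scalerDl; congr (_ *: _ + _ *: _); ring.
Qed.

(** If the bracket vanished, [bracket_plucker] would make [u] and [v] proportional, hence the same
    projective point. *)
Lemma bracket_neq0 l u v : is_line l -> u \in l -> v \in l -> u != 0 -> v != 0 ->
  <[u]>%VS != <[v]>%VS -> bracket (line_basis l) u v != 0.
Proof.
move=> l2 ul vl u0 v0; apply: contra_neq => uv0; set X := line_basis l in uv0.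
have bX : basis_of l X := line_basisP l2.
have dep w : w \in l -> bracket X w v *: u = bracket X w u *: v.
  move=> wl; have := bracket_plucker l2 ul vl wl; rewrite -/X uv0 scale0r => /esym/eqP.
  by rewrite addr_eq0 -scaleNr => /eqP->; congr (_ *: _); rewrite /bracket; ring.
(* One of the two basis vectors has a nonzero bracket with [v], since [v] has a nonzero
   coordinate. *)
have [w wl wv] : exists2 w, w \in l & bracket X w v != 0.
  have Xl i : (i < 2)%N -> X`_i \in l.
    by move=> i2; rewrite (basis_mem bX)// mem_nth// size_tuple.
  have E i : coord X i X`_0 = (i == ord0)%:R.
    by rewrite (coord_free ord0 i) ?(basis_free bX)// eq_sym.
  have F i : coord X i X`_1 = (i == ord_max)%:R.
    by rewrite (coord_free ord_max i) ?(basis_free bX)// eq_sym.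
  have E1 : (@ord_max 1 == ord0) = false by [].
  have [v1|v1] := eqVneq (coord X ord_max v) 0; last first.
    by exists X`_0; rewrite ?Xl// /bracket !E eqxx E1 mul1r mulr0 subr0.
  exists X`_1; rewrite ?Xl// /bracket !F eqxx (eq_sym ord0) E1 mul0r mulr1 sub0r oppr_eq0.
  apply: contra_neq v0 => v0; rewrite (coord2E bX vl) v0 v1.
  by rewrite !scale0r addr0.
have /(canRL (scalerK wv)) : bracket X w v *: u = bracket X w u *: v := dep w wl.
rewrite scalerA; set k := _ * _ => uE.
have k0 : k != 0 by apply: contra_neq u0 => k0; rewrite uE k0 scale0r.
apply/eqP; rewrite eqEsubv -!memvE; apply/andP; split; apply/vlineP.
  by exists k.
by exists k^-1; rewrite uE scalerA mulVf ?scale1r.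
Qed.

Lemma line_eq_bracket l l' u v : is_line l -> is_line l' ->
  u \in l -> v \in l -> u \in l' -> v \in l' ->
  bracket (line_basis l) u v != 0 -> l = l'.
Proof.
move=> l2 l2' ul vl ul' vl' uv0; apply/eqP.
rewrite -(geq_leqif (dimv_leqif_eq _)) ?l2 ?l2'//.
apply/subvP => w wl; have := bracket_plucker l2 ul vl wl.
move/(canRL (scalerK uv0)) => ->.
by rewrite memvZ// memvD// memvZ.
Qed.

End Line.

(** * Brackets and Menelaus' theorem in a Y-mesh *)

Section Mesh.
Variables (R : realType) (D : nat) (a b c d : Z2).
Variables (P L : Z2 -> {vspace 'rV[R]_(D.+1)}).
Hypothesis meshP : Y_mesh a b c d P L.
Let S := [:: a; b; c; d].

Definition mesh_bracket (r x y : Z2) : R :=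
  bracket (line_basis (L r)) (vpick (P (r + x))) (vpick (P (r + y))).

Lemma mesh_pointE r : P r = <[vpick (P r)]>%VS.
Proof.
have P1 := mesh_point meshP r.
apply/esym/eqP; rewrite -(geq_leqif (dimv_leqif_eq _)); last first.
  by rewrite -memvE memv_pick.
by rewrite P1 dim_vline vpick0 -dimv_eq0 P1.
Qed.

Lemma mesh_vpick_neq0 r : vpick (P r) != 0.
Proof. by rewrite vpick0 -dimv_eq0 (mesh_point meshP r). Qed.

Lemma mesh_vpick_in r x : x \in S -> vpick (P (r + x)) \in L r.
Proof.
move=> xS; rewrite memvE -mesh_pointE.
have /and4P[? ? ? ?] := mesh_incident meshP r.
by move: xS; rewrite !inE => /or4P[] /eqP->.
Qed.

Lemma uniq_map_neq (T U : eqType) (f : T -> U) (s : seq T) x y :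
  uniq (map f s) -> x \in s -> y \in s -> x != y -> f x != f y.
Proof.
move=> fs xs ys; apply: contra_neq => fxy; rewrite -(nth_index x xs) -[RHS](nth_index x ys).
congr nth; apply/eqP.
rewrite -(nth_uniq (f x) _ _ fs) ?size_map ?index_mem//.
by rewrite !(nth_map x) ?index_mem// !nth_index ?fxy.
Qed.

Lemma mesh_bracket_neq0 r x y : x \in S -> y \in S -> x != y ->
  mesh_bracket r x y != 0.
Proof.
move=> xS yS xy; apply: bracket_neq0; rewrite ?mesh_vpick_neq0 ?mesh_vpick_in//.
  exact: mesh_line meshP r.
rewrite -!mesh_pointE.
exact: (@uniq_map_neq _ _ (fun x => P (r + x)) S) (mesh_points_distinct meshP r) _ _ _.
Qed.

(** Both lines pass through [P (r + x + y)], and the lines through one mesh point are distinct. *)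
Lemma mesh_lines_neq r x y : x \in S -> y \in S -> x != y ->
  L (r + x) != L (r + y).
Proof.
move=> xS yS xy; have := mesh_lines_distinct meshP (r + x + y).
move/(@uniq_map_neq _ _ (fun z => L (r + x + y - z)) S) => /(_ _ _ yS xS).
by rewrite eq_sym addrK addrAC addrK; apply.
Qed.

Lemma mesh_plucker r x y z : x \in S -> y \in S -> z \in S ->
  mesh_bracket r x y *: vpick (P (r + z)) =
  mesh_bracket r z y *: vpick (P (r + x)) + mesh_bracket r x z *: vpick (P (r + y)).
Proof.
by move=> xS yS zS; apply: bracket_plucker; rewrite ?mesh_vpick_in//; exact: mesh_line meshP r.
Qed.

Lemma mesh_bracketC r x y : mesh_bracket r x y = - mesh_bracket r y x.
Proof. by rewrite /mesh_bracket /bracket; ring. Qed.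

(* The vertices of the triangle with side lines [L (r + y)], [L (r + z)], [L (r + w)]. *)
Lemma mesh_triangle_free r y z w : y \in S -> z \in S -> w \in S ->
  uniq [:: y; z; w] -> forall k1 k2 k3,
  k1 *: vpick (P (r + z + w)) + k2 *: vpick (P (r + y + w))
    + k3 *: vpick (P (r + y + z)) = 0 -> [/\ k1 = 0, k2 = 0 & k3 = 0].
Proof.
move=> yS zS wS; rewrite /= !inE negb_or => /and3P[/andP[yz yw] zw _] k1 k2 k3 K.
(* Otherwise [P (r + z + w)] would lie on [L (r + y)], which would then share two distinct points
   with [L (r + z)]. *)
have k10 : k1 = 0.
  apply/eqP; apply: contraT => k10.
  have /negP[] : L (r + z) != L (r + y) by rewrite mesh_lines_neq// eq_sym.
  apply/eqP; apply: (@line_eq_bracket _ _ _ _ (vpick (P (r + z + w))) (vpick (P (r + z + y)))).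
  - exact: mesh_line meshP _.
  - exact: mesh_line meshP _.
  - exact: mesh_vpick_in.
  - exact: mesh_vpick_in.
  - move: K; rewrite -addrA => /eqP; rewrite addr_eq0 => /eqP/(canRL (scalerK k10))->.
    by rewrite memvZ// memvN memvD// memvZ// mesh_vpick_in.
  - by rewrite addrAC mesh_vpick_in.
  - by apply: mesh_bracket_neq0; rewrite // eq_sym.
move: K; rewrite k10 scale0r add0r => K.
(* What is left is a relation on [L (r + y)]; bracketing it with either vertex kills the term of
   that vertex. *)
have Kw w' : k2 * bracket (line_basis (L (r + y))) (vpick (P (r + y + w))) w'
           + k3 * bracket (line_basis (L (r + y))) (vpick (P (r + y + z))) w' = 0.
  transitivity (bracket (line_basis (L (r + y))) (k2 *: vpick (P (r + y + w))
      + k3 *: vpick (P (r + y + z))) w').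
    by rewrite /bracket !linearD !linearZ/=; ring.
  by rewrite K /bracket !linear0 !mul0r mulr0 subrr.
have br0 u : bracket (line_basis (L (r + y))) u u = 0 by rewrite /bracket mulrC subrr.
have n0 := mesh_bracket_neq0 (r + y) zS wS zw.
have n1 : mesh_bracket (r + y) w z != 0 by rewrite mesh_bracket_neq0// eq_sym.
split=> //; apply/eqP.
  have/eqP := Kw (vpick (P (r + y + z))).
  by rewrite br0 mulr0 addr0 mulf_eq0 (negPf n1) orbF.
have/eqP := Kw (vpick (P (r + y + w))).
by rewrite br0 mulr0 add0r mulf_eq0 (negPf n0) orbF.
Qed.

(* Menelaus' theorem for the triangle with side lines [L (r + y)],
   [L (r + z)], [L (r + w)], cut by the transversal [L (r + x)]. *)
Lemma mesh_menelaus r x y z w : x \in S -> y \in S -> z \in S -> w \in S ->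
  uniq [:: x; y; z; w] ->
  mesh_bracket (r + y) x z * mesh_bracket (r + z) x w * mesh_bracket (r + w) x y =
  mesh_bracket (r + y) x w * mesh_bracket (r + z) x y * mesh_bracket (r + w) x z.
Proof.
move=> xS yS zS wS us.
have /and3P[xN yN zw] := us.
have {zw} zw : z != w by move: zw; rewrite /= inE => /andP[].
move: xN yN; rewrite !inE !negb_or => /and3P[xy xz xw] /andP[yz yw].
(* [Ty], [Tz], [Tw] express the points of the transversal through the triangle vertices on each side
   line; [Tx] is the collinearity of these three points. *)
have Ty := mesh_plucker (r + y) wS zS xS.
have Tz := mesh_plucker (r + z) wS yS xS.
have Tw := mesh_plucker (r + w) zS yS xS.
have Tx := mesh_plucker (r + x) zS wS yS.
rewrite ![r + _ + x]addrAC in Ty Tz Tw.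
rewrite [r + w + y]addrAC [r + w + z]addrAC in Tw.
rewrite [r + z + y]addrAC in Tz.
set A := vpick (P (r + z + w)) in Tz Tw.
set B := vpick (P (r + y + w)) in Ty Tw.
set C := vpick (P (r + y + z)) in Ty Tz.
have n1 := mesh_bracket_neq0 (r + y) wS zS.
have n2 := mesh_bracket_neq0 (r + z) wS yS.
have n3 := mesh_bracket_neq0 (r + w) zS yS.
have m1 := mesh_bracket_neq0 (r + x) zS wS zw.
have m2 := mesh_bracket_neq0 (r + x) yS wS yw.
have m3 := mesh_bracket_neq0 (r + x) zS yS.
move: n1 n2 n3 m3; rewrite [w == z]eq_sym [w == y]eq_sym [z == y]eq_sym.
move=> /(_ zw) n1 /(_ yw) n2 /(_ yz) n3 /(_ yz) m3.
move: Tx Ty Tz Tw; set Xy := vpick (P (r + x + y)); set Xz := vpick (P (r + x + z)).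
set Xw := vpick (P (r + x + w)).
rewrite (mesh_bracketC _ w x) (mesh_bracketC _ w x) (mesh_bracketC _ z x).
move: n1 n2 n3 m1 m2 m3.
set u1 := mesh_bracket _ w z; set u2 := mesh_bracket _ w y.
set u3 := mesh_bracket (r + w) z y; set t1 := mesh_bracket _ z w.
set t2 := mesh_bracket _ y w; set t3 := mesh_bracket _ z y.
set e1 := mesh_bracket _ x z; set f1 := mesh_bracket _ x w.
set e2 := mesh_bracket _ x w; set f2 := mesh_bracket _ x y.
set e3 := mesh_bracket _ x y; set f3 := mesh_bracket _ x z.
move=> n1 n2 n3 m1 m2 m3 Tx Ty Tz Tw.
have us' : uniq [:: y; z; w] by case/andP: us.
(* These are the coefficients of the vertices after substituting [Ty], [Tz], [Tw] into
   [u1 * u2 * u3] times [Tx]. *)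
have [|k1 k2 k3] := @mesh_triangle_free r y z w yS zS wS us'
    (u1 * (t2 * u3 * f2 + t3 * u2 * e3)) (- u2 * (t1 * u3 * e1 + t3 * u1 * f3))
    (u3 * (t1 * u2 * f1 - t2 * u1 * e2)).
  rewrite -/A -/B -/C; apply/rowP => j.
  move: Tx Ty Tz Tw => /rowP/(_ j) + /rowP/(_ j) + /rowP/(_ j) + /rowP/(_ j).
  rewrite !mxE => Tx Ty Tz Tw.
  transitivity (u1 * u3 * t2 * (u2 * Xz 0 j) + u1 * u2 * t3 * (u3 * Xw 0 j)
    - u2 * u3 * t1 * (u1 * Xy 0 j)); first by rewrite Ty Tz Tw; ring.
  transitivity (u1 * u2 * u3 * (t2 * Xz 0 j + t3 * Xw 0 j - t1 * Xy 0 j)); first by ring.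
  by rewrite Tx; ring.
move/eqP: k1; rewrite mulf_eq0 (negPf n1) addr_eq0/= => /eqP k1.
move/eqP: k2; rewrite mulf_eq0 oppr_eq0 (negPf n2) addr_eq0/= => /eqP k2.
move/eqP: k3; rewrite mulf_eq0 (negPf n3) subr_eq0/= => /eqP k3.
(* Multiplying the three equations gives the claim times this common factor; the two minus signs
   cancel. *)
have n0 : t1 * t2 * t3 * u1 * u2 * u3 != 0 by rewrite !mulf_neq0.
apply: (mulfI n0).
transitivity ((t1 * u3 * e1) * (t2 * u1 * e2) * (t3 * u2 * e3)); first by ring.
rewrite k2 -k3; transitivity (- (t3 * u1 * f3 * (t1 * u2 * f1) * (t3 * u2 * e3))); first by ring.
by rewrite -[t3 * u2 * e3]opprK -k1; ring.
Qed.

Lemma mesh_y_relation : uniq S -> Y_relation a b c d (mesh_y a b c d P L).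
Proof.
move=> us r.
have inS : [/\ a \in S, b \in S, c \in S & d \in S].
  by rewrite !inE !eqxx !orbT.
have [aS bS cS dS] := inS.
have us' := us; move: us'; rewrite /= !inE !negb_or -!andbA.
move=> /and5P[ab ac ad bc /andP[bd /andP[cd _]]].
pose br x y := mesh_bracket (r + x + y).
have brC x y p q : br x y p q = br y x p q by rewrite /br addrAC.
have nz x y p q : p \in S -> q \in S -> p != q -> br x y p q != 0.
  exact: mesh_bracket_neq0.
have yE x y : mesh_y a b c d P L (r + x + y) =
    (br x y a c * br x y b d) / (br x y c b * br x y a d).
  rewrite /mesh_y /cross_ratio /cross_ratio_of -!/(mesh_bracket _ _ _) -!/(br _ _ _ _).
  by rewrite [br x y d a]mesh_bracketC -/(br _ _ _ _) mulrN invrN mulrN opprK.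
(* The three-term relation [[ab][cd] = [ac][bd] + [ad][cb]] makes [1 + y], and below [1 + y^-1], a
   single quotient of brackets. *)
have y1E x y : 1 + mesh_y a b c d P L (r + x + y) =
    (br x y a b * br x y c d) / (br x y c b * br x y a d).
  have n1 : br x y c b != 0 by rewrite nz// eq_sym.
  have n2 : br x y a d != 0 by rewrite nz.
  rewrite yE -[X in X + _](divff (mulf_neq0 n1 n2)) -mulrDl; congr (_ / _).
  by rewrite /br /mesh_bracket /bracket; ring.
have y1VE x y : 1 + (mesh_y a b c d P L (r + x + y))^-1 =
    (br x y a b * br x y c d) / (br x y a c * br x y b d).
  have n1 : br x y a c != 0 by rewrite nz.
  have n2 : br x y b d != 0 by rewrite nz.
  rewrite yE invf_div -[X in X + _](divff (mulf_neq0 n1 n2)) -mulrDl.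
  by congr (_ / _); rewrite /br /mesh_bracket /bracket; ring.
rewrite !y1E !y1VE !yE.
have Ma := @mesh_menelaus (r + a) a b c d aS bS cS dS us.
have [Mb Mc Md] : [/\ uniq [:: b; a; c; d], uniq [:: c; a; b; d] & uniq [:: d; a; b; c]].
  rewrite /= !inE !negb_or [b == a]eq_sym [c == a]eq_sym [d == a]eq_sym.
  by rewrite [c == b]eq_sym [d == b]eq_sym [d == c]eq_sym ab ac ad bc bd cd.
move: Mb Mc Md => /(mesh_menelaus (r + b) bS aS cS dS) Mb.
move=> /(mesh_menelaus (r + c) cS aS bS dS) Mc.
move=> /(mesh_menelaus (r + d) dS aS bS cS) Md.
rewrite -!/(br _ _ _ _) in Ma Mb Mc Md.
rewrite !(brC b a, brC c a, brC c b, brC d a, brC d b, brC d c) in Mb Mc Md.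
rewrite !mulf_div invf_div mulf_div; apply/eqP; rewrite eqr_div; last 2 first.
- by rewrite !mulf_neq0 ?nz// eq_sym.
- by rewrite !mulf_neq0 ?nz// eq_sym.
have opp x y p q : br x y p q = - br x y q p by exact: mesh_bracketC.
apply/eqP.
(* Up to signs, one side of the relation collects the left sides of [Ma], [Mc] and the right sides
   of [Mb], [Md]; exchanging the sides of all four gives the other. *)
transitivity ((br a b a c * br a c a d * br a d a b) * (br a b b d * br b c b a * br b d b c)
  * (br a c c b * br b c c d * br c d c a) * (br a d d c * br b d d a * br c d d b)).
  by rewrite !(opp _ _ c b, opp _ _ b a, opp _ _ c a, opp _ _ d a, opp _ _ d b, opp _ _ d c); ring.
rewrite Ma -Mb Mc -Md.
by rewrite !(opp _ _ c b, opp _ _ b a, opp _ _ c a, opp _ _ d a, opp _ _ d b, opp _ _ d c); ring.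
Qed.

End Mesh.

(** * Involutivity of mutations *)

Section Involution.
Local Open Scope classical_set_scope.
Variables (V : choiceType) (M : set V).
Implicit Types q : arrows V.

Lemma quiver_mut_in q u w : M u \/ M w -> quiver_mut M q u w = q w u.
Proof. by move=> uw; rewrite /quiver_mut asboolT. Qed.

(** The paths through [M] are turned around by the first mutation, so the second one takes back
    their contribution to the signed arrow counts. Without 2-cycles these counts determine [q]. *)
Lemma quiver_mutK q : (forall u v, q u v = 0%N \/ q v u = 0%N) ->
  quiver_mut M (quiver_mut M q) = q.
Proof.
move=> q2; apply/funext => u; apply/funext => w.
rewrite {1}/quiver_mut; case: asboolP => uw; first by rewrite quiver_mut_in// or_comm.
have pE u' w' : paths_through M (quiver_mut M q) u' w' = paths_through M q w' u'.
  apply: eq_fsbigr => v; rewrite inE => Mv.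
  by rewrite !quiver_mut_in 1?mulnC; [|left|right].
rewrite !pE /quiver_mut asboolF// asboolF; last by rewrite or_comm.
by have := q2 u w; lia.
Qed.

Lemma fsbig_prod_neq0 (F : fieldType) (g : V -> F) :
  (forall v, M v -> g v != 0) -> \big[*%R/1]_(v \in M) g v != 0.
Proof.
move=> g0; rewrite prodf_seq_neq0; apply/allP => v.
by case: finite_supportP => // X XM _ _ /XM/g0 ->.
Qed.

(** Inverting the variables in [M] and reversing the arrows exchanges the two products, which then
    cancel because they are nonzero. *)
Lemma y_mutK (F : fieldType) q (y : V -> F) :
  (forall v, M v -> y v != 0 /\ 1 + y v != 0) ->
  y_mut M (quiver_mut M q) (y_mut M q y) = y.
Proof.
move=> y0; apply/funext => u.
have inM v : M v -> y_mut M q y v = (y v)^-1 by move=> Mv; rewrite /y_mut asboolT.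
rewrite {1}/y_mut; case: asboolP => Mu; first by rewrite inM ?invrK.
have -> : \big[*%R/1]_(v \in M) (1 + y_mut M q y v) ^+ quiver_mut M q u v =
          \big[*%R/1]_(v \in M) (1 + (y v)^-1) ^+ q v u.
  by apply: eq_fsbigr => v; rewrite inE => Mv; rewrite inM// quiver_mut_in//; right.
have -> : \big[*%R/1]_(v \in M) (1 + (y_mut M q y v)^-1) ^+ quiver_mut M q v u =
          \big[*%R/1]_(v \in M) (1 + y v) ^+ q u v.
  by apply: eq_fsbigr => v; rewrite inE => Mv; rewrite inM// invrK quiver_mut_in//; left.
rewrite /y_mut asboolF//.
have n1 : \big[*%R/1]_(v \in M) (1 + (y v)^-1) ^+ q v u != 0.
  apply: fsbig_prod_neq0 => v Mv; have [yv yv1] := y0 v Mv.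
  by rewrite expf_neq0// -(mulVf yv) -{2}[(y v)^-1]mulr1 -mulrDr mulf_neq0 ?invr_eq0// addrC.
have n2 : \big[*%R/1]_(v \in M) (1 + y v) ^+ q u v != 0.
  by apply: fsbig_prod_neq0 => v Mv; have [yv yv1] := y0 v Mv; rewrite expf_neq0.
by rewrite mulfVK// mulfK.
Qed.

Lemma fsbig_pick (T : Type) (idx : T) (op : Monoid.com_law idx) (w : V) (k : T) :
  \big[op/idx]_(v \in M) (if v == w then k else idx) =
  if `[< M w >] then k else idx.
Proof.
case: asboolP => Mw.
  rewrite -(@fsbig_widen _ _ _ op [set w] M); last 2 first.
  - by move=> v ->.
  - by move=> v [_ /eqP/negPf] /= ->.
  by rewrite fsbig_set1 eqxx.
by apply: fsbig1 => v Mv; case: eqP => // vw; rewrite vw in Mv.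
Qed.

(** Meant for a row of vertices, at most two of which matter for a given vertex. Two separate
    factors also cover [w1 = w2]. *)
Lemma fsbig_pick2 (T : eqType) (idx : T) (op : Monoid.com_law idx) (w1 w2 : V)
    (k1 k2 : V -> T) (g : V -> T) :
  (forall v, M v -> g v = op (if v == w1 then k1 v else idx) (if v == w2 then k2 v else idx)) ->
  \big[op/idx]_(v \in M) g v =
  op (if `[< M w1 >] then k1 w1 else idx) (if `[< M w2 >] then k2 w2 else idx).
Proof.
move=> gE; rewrite -(fsbig_pick op w1 (k1 w1)) -(fsbig_pick op w2 (k2 w2)).
(* Splitting the operator needs a finite index set; outside [N] every family involved is trivial. *)
pose N := M `&` [set` [:: w1; w2]].
have NM : N `<=` M by move=> v [].
have Nf : finite_set N by apply: sub_finite_set (finite_seq [:: w1; w2]) => v [].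
have out v : (M `\` N) v -> (v == w1 = false) * (v == w2 = false).
  move=> [Mv nN]; split; apply/negP => /eqP E; apply: nN; split => //=;
  by rewrite E !inE eqxx ?orbT.
have gN v : M v -> g v = op (if v == w1 then k1 w1 else idx) (if v == w2 then k2 w2 else idx).
  by move=> /gE ->; do 2![case: eqP => [<-|_]].
rewrite -!(@fsbig_widen _ _ _ op N M) //; first last.
- by move=> v Mv /=; rewrite gN ?out ?Monoid.mul1m//; case: Mv.
- by move=> v Mv /=; rewrite !out.
- by move=> v Mv /=; rewrite !out.
rewrite -fsbig_split//; apply: eq_fsbigr => v; rewrite inE => /NM; exact: gN.
Qed.

End Involution.

(** * States at all integer times *)

Section Evolve.
Variables (T : Type) (mu : int -> T -> T).

Lemma evolve_pos x (n : nat) : evolve mu x n.+1 = mu n (evolve mu x n).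
Proof. by []. Qed.

Lemma evolve_neg x (n : nat) : evolve mu x (Negz n) = mu (Negz n) (evolve mu x (- n%:Z)).
Proof. by case: n => // n; rewrite -NegzE. Qed.

(** [evolve] runs away from time 0 in both directions, so at negative times the forward step undoes
    a move; involutivity is asked only at the states met there. *)
Lemma evolve_succ x :
  (forall n : nat, mu (Negz n) (mu (Negz n) (evolve mu x (- n%:Z))) = evolve mu x (- n%:Z)) ->
  forall t, evolve mu x (t + 1) = mu t (evolve mu x t).
Proof.
move=> muK [] n; first by rewrite -PoszD addn1.
have -> : Negz n + 1 = - n%:Z by lia.
by rewrite evolve_neg muK.
Qed.

Lemma int_ind_from0 (P : int -> Prop) : P 0 -> (forall n : nat, P n -> P n.+1) ->
  (forall n : nat, P (- n%:Z) -> P (Negz n)) -> forall t, P t.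
Proof.
move=> P0 Pp Pn [] n; first by elim: n.
by apply: (Pn n); elim: n => [//|n IH]; rewrite -NegzE; exact: (Pn n).
Qed.

Lemma evolveE (st : int -> T) :
  (forall t, mu t (st t) = st (t + 1)) -> (forall t, mu t (st (t + 1)) = st t) ->
  forall t, evolve mu (st 0) t = st t.
Proof.
move=> muS muP; elim/int_ind_from0 => [//|n IH|n IH].
  by rewrite evolve_pos IH muS -PoszD addn1.
by rewrite evolve_neg IH -[RHS]muP; congr (mu _ (st _)); lia.
Qed.

End Evolve.

Lemma seed_at_quiver (V : choiceType) (F : fieldType) (s : Y_seed V F) (M : int -> set V) t :
  (seed_at s M t).1 = quiver_at s.1 M t.
Proof.
rewrite /seed_at /quiver_at.
by elim/int_ind_from0: t => [//|n IH|n IH]; rewrite ?evolve_pos ?evolve_neg /= IH.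
Qed.

(** * Rows of the plane modulo a period *)

Definition height (r : Z2) : int := r.2.

Section Window.
Variable p : Z2.
Hypothesis p_gt0 : 0 < height p.

Lemma height_add (r s : Z2) : height (r + s) = height r + height s. Proof. by []. Qed.
Lemma height_opp (r : Z2) : height (- r) = - height r. Proof. by []. Qed.
Lemma height_mulz (r : Z2) (k : int) : height (r *~ k) = height r * k.
Proof. by rewrite /height (raddfMz (@snd int int)) mulrzz. Qed.
Definition heightE := (height_add, height_opp, height_mulz).

Definition in_window (t : int) (r : Z2) : bool := (t <= height r) && (height r < t + height p).

(** Points of one class differ in height by a multiple of [height p], the number of rows in a
    window. *)
Lemma window_inj t r s k : in_window t r -> in_window t s -> s = r + p *~ k -> s = r.
Proof.
move=> rt st sE; suff k0 : k = 0 by rewrite sE k0 mulr0z addr0.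
by move: rt st; rewrite /in_window sE !heightE; nia.
Qed.

(* Representative modulo [p] in the rows [t, ..., t + height p - 1]. *)
Definition shift_to (t : int) (r : Z2) : Z2 := r + p *~ (- ((height r - t) %/ height p)%Z).

Lemma shift_to_window t r : in_window t (shift_to t r).
Proof.
rewrite /in_window /shift_to !heightE.
have := divz_eq (height r - t) (height p); have := modz_ge0 (height r - t) (lt0r_neq0 p_gt0).
have := ltz_pmod (height r - t) p_gt0; set m := modz _ _; set e := divz _ _; nia.
Qed.

Lemma shift_toP t r s : in_window t s ->
  (exists k : int, s = r + p *~ k) <-> shift_to t r = s.
Proof.
move=> st; split=> [[k sE]|<-]; last by eexists.
apply: (@window_inj t s (shift_to t r) (- ((height r - t) %/ height p)%Z - k)) => //.
  exact: shift_to_window.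
by rewrite sE /shift_to mulrzBr -addrA; congr (_ + _); rewrite addrC subrK.
Qed.

Lemma shift_to_id t r : in_window t r -> shift_to t r = r.
Proof. by move=> rt; apply/shift_toP => //; exists 0; rewrite mulr0z addr0. Qed.

Lemma shift_toE t r : exists k, shift_to t r = r + p *~ k.
Proof. by eexists. Qed.

Lemma shift_toK t t' r : shift_to t (shift_to t' r) = shift_to t r.
Proof.
apply/shift_toP; first exact: shift_to_window.
have [k ->] := shift_toE t' r; have [k' ->] := shift_toE t r.
by exists (k' - k); rewrite mulrzBr addrA addrAC addrK.
Qed.

Lemma shift_to_eqP t r s : shift_to t r = shift_to t s <-> exists k : int, s - r = p *~ k.
Proof.
split=> [/esym|[k /eqP]].
  have [k ->] := shift_toE t r; have [k' ->] := shift_toE t s => E.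
  exists (k - k'); rewrite mulrzBr; apply/eqP; rewrite subr_eq addrAC.
  by rewrite [p *~ k + r]addrC -E addrK.
rewrite subr_eq => /eqP sE; apply/shift_toP; first exact: shift_to_window.
have [k' ->] := shift_toE t s.
by exists (k + k'); rewrite sE mulrzDr -addrA addrCA addrA.
Qed.

(** Raising the window by one row drops row [t], whose classes reappear [p] higher, in the new top
    row. *)
Lemma shift_to_succ t r : shift_to (t + 1) r =
  if height (shift_to t r) == t then shift_to t r + p else shift_to t r.
Proof.
have := shift_to_window t r; rewrite /in_window => w.
have [k rE] := shift_toE t r.
case: eqP => rt; apply/shift_toP.
- by rewrite /in_window height_add; move: w rt p_gt0; set x := height (shift_to t r); lia.
- by exists (k + 1); rewrite rE mulrzDr mulr1z addrA.
- by rewrite /in_window; move: w rt p_gt0; set x := height (shift_to t r); lia.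
- by exists k.
Qed.

(** The quotient of Z^2 by the multiples of [p], encoded by the representatives in rows
    [0, ..., height p - 1]. *)
Definition residue : choiceType := {r : Z2 | in_window 0 r}.

Definition label (r : Z2) : residue := exist _ (shift_to 0 r) (shift_to_window 0 r).

(** The height of this representative is the first time from [t] on at which [v] is mutated. *)
Definition lift_to (t : int) (v : residue) : Z2 := shift_to t (val v).

Lemma lift_to_label t r : lift_to t (label r) = shift_to t r.
Proof. exact: shift_toK. Qed.

Lemma lift_toK t v : label (lift_to t v) = v.
Proof. by apply: val_inj => /=; rewrite shift_toK shift_to_id//; case: v. Qed.

Lemma label_eqP r s : label r = label s <-> exists k : int, s - r = p *~ k.
Proof.
rewrite -(shift_to_eqP 0); split=> [/(congr1 val)//|E]; exact: val_inj.
Qed.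

Lemma lift_to_window t v : in_window t (lift_to t v).
Proof. exact: shift_to_window. Qed.

Definition row_set (t : int) : set residue := [set v | height (lift_to t v) = t]%classic.

Lemma lift_to_succ t v : lift_to (t + 1) v =
  if height (lift_to t v) == t then lift_to t v + p else lift_to t v.
Proof. exact: shift_to_succ. Qed.

Lemma in_window_height t (r : Z2) : height r = t -> in_window t r.
Proof. by rewrite /in_window => ->; rewrite lexx ltrDl. Qed.

Lemma row_setP t v : row_set t v <-> exists2 r : Z2, height r = t & label r = v.
Proof.
split=> [vt|[r rt <-]]; first by exists (lift_to t v); rewrite ?lift_toK.
by rewrite /row_set/mkset lift_to_label shift_to_id// in_window_height.
Qed.
End Window.

(** * The quiver of a Y-pin *)

Section MeshQuiver.
Variables x1 x2 z1 z2 p : Z2.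
Hypotheses (x12 : x1 + x2 = p) (z12 : z1 + z2 = p).
Hypotheses (x1_gt0 : 0 < height x1) (x2_gt0 : 0 < height x2).
Hypotheses (z1_gt0 : 0 < height z1) (z2_gt0 : 0 < height z2).
Hypothesis xz_disjoint : [&& x1 != z1, x1 != z2, x2 != z1 & x2 != z2].

Lemma period_gt0 : 0 < height p.
Proof. by rewrite -x12 height_add addr_gt0. Qed.

Local Notation residue := (residue p).
Local Notation label := (label period_gt0).
Local Notation window := (@lift_to_window p period_gt0).

(** Counted with multiplicity: [x1 = x2] gives a double arrow. *)
Definition in_x (h : Z2) : nat := ((h == x1) + (h == x2))%N.
Definition in_z (h : Z2) : nat := ((h == z1) + (h == z2))%N.

Lemma eq_complement (u v h : Z2) : u + v = p -> (p - h == u) = (h == v).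
Proof. by move=> <-; rewrite subr_eq (inj_eq (addrI _)) eq_sym. Qed.

Lemma in_x_sym h : in_x (p - h) = in_x h.
Proof. by rewrite /in_x (eq_complement _ x12) (@eq_complement x2 x1) 1?addrC// addnC. Qed.

Lemma in_z_sym h : in_z (p - h) = in_z h.
Proof. by rewrite /in_z (eq_complement _ z12) (@eq_complement z2 z1) 1?addrC// addnC. Qed.

Lemma in_x_height h : ~~ (0 < height h < height p) -> in_x h = 0%N.
Proof.
by rewrite /in_x -x12 height_add; do 2!case: eqP => [->|_] //=; lia.
Qed.

Lemma in_z_height h : ~~ (0 < height h < height p) -> in_z h = 0%N.
Proof.
by rewrite /in_z -z12 height_add; do 2!case: eqP => [->|_] //=; lia.
Qed.

(** Keeps incoming and outgoing arrows at a mutated vertex from cancelling. *)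
Lemma in_xz_disjoint h : in_x h = 0%N \/ in_z h = 0%N.
Proof.
have /and4P[/negPf a1 /negPf a2 /negPf a3 /negPf a4] := xz_disjoint.
rewrite /in_x /in_z; case: eqP => [->|_]; first by rewrite a1 a2; right.
by case: eqP => [->|_]; [rewrite a3 a4; right|left].
Qed.

(* When row [t] is mutated, a vertex [v] of that row has an arrow to [v + h]
   for [h] in [z1, z2] and an arrow from [v + h] for [h] in [x1, x2]. So
   [two_step_at t s s'] counts the paths [s -> v -> s'] with [v] in row [t], and
   [two_step_past t s s'] those with [v] in row [t] or any later row. *)
Definition two_step_past (t : int) (s s' : Z2) : nat :=
  ((t + height x1 <= height s)%R * in_z (s' - s + x1)%R +
   (t + height x2 <= height s)%R * in_z (s' - s + x2)%R)%N.

Definition two_step_at (t : int) (s s' : Z2) : nat :=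
  ((height s == t + height x1)%R * in_z (s' - s + x1)%R +
   (height s == t + height x2)%R * in_z (s' - s + x2)%R)%N.

(* The signed number of arrows from [s] to [s'], for representatives in rows
   [t, ..., t + height p - 1], is [weight t s s' - weight t s' s]. This undoes
   the arrows that the mutations at rows [t], [t + 1], ... will create, so that
   just before row [height s] is mutated only the arrows of [in_z] and [in_x]
   are left at [s]. *)
Definition weight (t : int) (s s' : Z2) : nat :=
  (in_z (s' - s)%R + in_x (s - s')%R + two_step_past t s' s)%N.

Definition mesh_quiver (t : int) : arrows residue := fun u v =>
  (weight t (lift_to t u) (lift_to t v) - weight t (lift_to t v) (lift_to t u))%N.

Lemma two_step_pastS t s s' :
  two_step_past t s s' = (two_step_past (t + 1) s s' + two_step_at t s s')%N.
Proof.
have E (x : int) :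
    (t + x <= height s)%R = ((t + 1 + x <= height s)%R + (height s == t + x)%R)%N :> nat.
  by case: eqP => ?; case: leP => ?; case: leP => ? //=; lia.
by rewrite /two_step_past /two_step_at !E !mulnDl addnACA.
Qed.

(** As [v] is in the bottom row of the window, the other terms of the weight count displacements of
    nonpositive height. *)
Lemma weight_from t v s : height v = t -> in_window p t s -> weight t v s = in_z (s - v).
Proof.
move=> vt /andP[ts st]; rewrite /weight /two_step_past.
have E (x : Z2) : ((t + height x <= height s)%R * in_z (v - s + x)%R)%N = 0%N.
  case: leP => // xs; rewrite mul1n in_z_height// !heightE vt; lia.
by rewrite !E in_x_height ?addn0// !heightE vt; lia.
Qed.

Lemma weight_to t v s : height v = t -> in_window p t s -> weight t s v = in_x (s - v).
Proof.
move=> vt /andP[ts st]; rewrite /weight /two_step_past.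
rewrite in_z_height ?vt; last by rewrite !heightE vt; lia.
have -> : (t + height x1 <= t) = false by lia.
have -> : (t + height x2 <= t) = false by lia.
by rewrite addn0.
Qed.

Lemma mesh_quiver_from t u v : row_set t v ->
  mesh_quiver t v u = in_z (lift_to t u - lift_to t v).
Proof.
move=> vt; rewrite /mesh_quiver (weight_from vt) ?(weight_to vt) ?window//.
by case: (in_xz_disjoint (lift_to t u - lift_to t v)) => ->; rewrite ?subn0.
Qed.

Lemma mesh_quiver_to t u v : row_set t v ->
  mesh_quiver t u v = in_x (lift_to t u - lift_to t v).
Proof.
move=> vt; rewrite /mesh_quiver (weight_from vt) ?(weight_to vt) ?window//.
by case: (in_xz_disjoint (lift_to t u - lift_to t v)) => ->; rewrite ?subn0.
Qed.

Lemma mesh_quiver_disconnected t : disconnected (mesh_quiver t) (row_set t).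
Proof.
move=> u v ut vt; rewrite mesh_quiver_to// in_x_height//.
by rewrite height_add height_opp ut vt subrr ltxx.
Qed.

Lemma mesh_quiver_2cycle t u v : mesh_quiver t u v = 0%N \/ mesh_quiver t v u = 0%N.
Proof. by rewrite /mesh_quiver; lia. Qed.

Lemma weightS t s s' : (weight t s s' = weight (t + 1) s s' + two_step_at t s' s)%N.
Proof. by rewrite /weight two_step_pastS addnA. Qed.

(** The hypotheses make the height cut-offs void. Then [h -> p - h] takes [s' - s + x1] to
    [s - s' + x2] and matches the two sums crosswise. *)
Lemma two_step_sym t s s' :
  (forall x, x \in [:: x1; x2] -> (t + height x <= height s) || (in_z (s' - s + x) == 0%N)) ->
  (forall x, x \in [:: x1; x2] -> (t + height x <= height s') || (in_z (s - s' + x) == 0%N)) ->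
  two_step_past t s s' = two_step_past t s' s.
Proof.
move=> sP s'P.
have E (r r' x : Z2) :
  (t + height x <= height r) || (in_z (r' - r + x) == 0%N) -> 
  ((t + height x <= height r)%R * in_z (r' - r + x)%R)%N = in_z (r' - r + x).
  by case: leP; rewrite ?mul1n//= mul0n => _ /eqP->.
rewrite /two_step_past !E ?sP ?s'P ?inE ?eqxx ?orbT//.
rewrite -in_z_sym -[in_z (s' - s + x2)%R]in_z_sym addnC -{1 2}x12.
by congr (in_z _ + in_z _)%N; rewrite !opprD !opprK; ring.
Qed.

Lemma lift_to_sub t (s x : Z2) : height s = t + height x -> lift_to t (label (s - x)) = s - x.
Proof.
move=> st; rewrite lift_to_label (shift_to_id period_gt0)//.
by apply: (in_window_height period_gt0); rewrite height_add height_opp st addrK.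
Qed.

Lemma row_set_eq t s x v : row_set t v ->
  (s - lift_to t v == x) = (height s == t + height x) && (v == label (s - x)).
Proof.
move=> vt; apply/eqP/andP => [sx|[/eqP st /eqP ->]].
  have vE : lift_to t v = s - x by rewrite -sx opprB addrC subrK.
  split; last by rewrite -vE lift_toK.
  by rewrite -vt vE height_add height_opp subrK.
by rewrite lift_to_sub// opprB addrC subrK.
Qed.

Lemma row_set_sub t (s x : Z2) : height s = t + height x -> row_set t (label (s - x)).
Proof. by move=> st; rewrite /row_set/mkset lift_to_sub// height_add height_opp st addrK. Qed.

(** Serves path counts and y-variables alike: the only candidate in row [t] lying [x] below [s] is
    the class of [s - x]. *)
Lemma fsbig_row (T : eqType) (idx : T) (op : Monoid.com_law idx) t s (x y : Z2)
    (g k : residue -> T) :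
  (forall v, row_set t v -> g v = op (if s - lift_to t v == x then k v else idx)
                                     (if s - lift_to t v == y then k v else idx)) ->
  \big[op/idx]_(v \in row_set t) g v =
  op (if height s == t + height x then k (label (s - x)) else idx)
     (if height s == t + height y then k (label (s - y)) else idx).
Proof.
move=> gE; pose k' (z : Z2) v := if height s == t + height z then k v else idx.
rewrite (@fsbig_pick2 _ _ _ _ op (label (s - x)) (label (s - y)) (k' x) (k' y)).
  have E (z : Z2) : (if `[< row_set t (label (s - z)) >] then k' z (label (s - z)) else idx) =
             if height s == t + height z then k (label (s - z)) else idx.
    rewrite /k'; case: eqP => [/row_set_sub st|_]; last by case: ifP.
    by rewrite asboolT.
  by rewrite !E.
move=> v vt; rewrite gE// !row_set_eq// /k'.
by congr (op _ _); case: (height s == _); case: (v == _).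
Qed.

Lemma paths_through_row t u w :
  paths_through (row_set t) (mesh_quiver t) u w =
  two_step_at t (lift_to t u) (lift_to t w).
Proof.
set s := lift_to t u; set s' := lift_to t w.
rewrite /paths_through (@fsbig_row _ _ _ t s x1 x2 _ (fun v => in_z (s' - lift_to t v))).
  have E (x : Z2) : (if height s == t + height x
                     then in_z (s' - lift_to t (label (s - x))) else 0%N) =
      ((height s == t + height x)%R * in_z (s' - s + x)%R)%N.
    by case: eqP => // /lift_to_sub ->; rewrite mul1n opprB addrA addrAC.
  by rewrite !E.
move=> v vt; rewrite mesh_quiver_to// mesh_quiver_from// -/s -/s' /in_x mulnDl.
by do 2!case: eqP => _; rewrite ?mul1n ?mul0n.
Qed.

(** Here [r] is in the top row of the window, so its cut-offs hold; where one fails for [s], the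
    displacement has height at least [height p] and counts nothing. *)
Lemma two_step_past_sym t r s :
  t + height p <= height r + 1 -> height r < t + height p -> t <= height s ->
  two_step_past t r s = two_step_past t s r.
Proof.
move=> tr rt ts; apply: two_step_sym => x; rewrite !inE => xP; apply/orP.
  by left; move: xP tr; rewrite -x12 height_add => /orP[] /eqP ->; lia.
have [|ltxs] := leP (t + height x) (height s); [by left|right].
by rewrite in_z_height// !height_add height_opp; move: tr rt; lia.
Qed.

(** Away from row [t], the mutation adds exactly the paths that [weight (t + 1)] no longer
    compensates. At row [t], reversing the arrows agrees with moving its vertices up by [p]. *)
Lemma mesh_quiver_mut t : quiver_mut (row_set t) (mesh_quiver t) = mesh_quiver (t + 1).
Proof.
have pgt := period_gt0.
have zz h : 0 = height h -> (in_z h = 0%N) * (in_x h = 0%N).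
  by move=> h0; rewrite in_z_height ?in_x_height// -h0 ltxx.
have wrap u w : row_set t u ->
    mesh_quiver t w u = mesh_quiver (t + 1) u w /\
    mesh_quiver t u w = mesh_quiver (t + 1) w u.
  move=> ut; have ut' : height (lift_to t u) = t by [].
  rewrite (mesh_quiver_to w ut) (mesh_quiver_from w ut) /mesh_quiver.
  rewrite !(lift_to_succ period_gt0) ut' eqxx.
  have /andP[ts st] := window t w.
  move: (lift_to t u) (lift_to t w) ut' ts st => r s rt ts st.
  case: eqP => [st'|/eqP st'].
    rewrite /weight (@two_step_past_sym _ (r + p)) ?height_add ?rt ?st'; [|lia..].
    by rewrite !zz ?height_add ?height_opp ?height_add ?rt ?st'; lia.
  (* The two-step terms cancel. The displacement from [r + p] to [s] points down, so only counts at
     [p - (s - r)] remain, and these equal the counts at [s - r]. *)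
  rewrite /weight (@two_step_past_sym _ (r + p)) ?height_add ?rt; [|lia..].
  have -> : s - (r + p) = - (p - (s - r)) by rewrite opprB opprD addrA.
  have -> : r + p - s = p - (s - r) by rewrite opprB addrCA addrA.
  have hN : height (- (p - (s - r))) <= 0.
    by rewrite !(height_add, height_opp) rt; lia.
  rewrite in_x_sym in_z_sym (@in_z_height (- _)) 1?(@in_x_height (- _)); [|lia..].
  by case: (in_xz_disjoint (s - r)) => ->; lia.
have stay (u : residue) : ~ row_set t u -> lift_to (t + 1) u = lift_to t u.
  by move=> /eqP/negPf ut; rewrite (lift_to_succ period_gt0) ut.
apply/funext => u; apply/funext => w; rewrite /quiver_mut.
case: asboolP => [[ut|wt]|/not_orP[ut wt]].
- by have [] := wrap _ w ut.
- by have [] := wrap _ u wt.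
- rewrite !paths_through_row /mesh_quiver !stay//.
  by rewrite (@weightS t (lift_to t u)) (@weightS t (lift_to t w)); lia.
Qed.

Lemma mesh_quiver_is_quiver t : is_quiver (mesh_quiver t).
Proof.
split=> [u|u v|u].
- by rewrite /mesh_quiver subnn.
- exact: mesh_quiver_2cycle.
pose s := lift_to t u.
(* Up to sign, all displacements at which a term of [weight] can be nonzero; they bound the
   neighbours of [u]. *)
pose H := [:: z1; z2; x1; x2; z1 - x1; z2 - x1; z1 - x2; z2 - x2].
pose N := [seq label (s + h) | h <- H ++ map -%R H].
apply: sub_finite_set (finite_seq N) => v /=; apply: contraTT => vN.
have nN h : h \in H ++ map -%R H -> (lift_to t v - s == h) = false.
  move=> hN; apply: contraNF vN => /eqP E.
  by apply/mapP; exists h; rewrite // -E addrC subrK lift_toK.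
have addE (h x z : Z2) : (h + x == z) = (h == z - x) by rewrite eq_sym -subr_eq eq_sym.
have flip h : (s - lift_to t v == h) = (lift_to t v - s == - h).
  by rewrite -opprB eqr_oppLR.
rewrite /mesh_quiver /weight /two_step_past /in_x /in_z -/s.
rewrite ![_ + x1 == _]addE ![_ + x2 == _]addE !flip.
by rewrite !nN ?muln0// !inE eqxx ?orbT.
Qed.

Lemma quiver_at_mesh t : quiver_at (mesh_quiver 0) (@row_set p) t = mesh_quiver t.
Proof.
apply: evolveE => {}t; first exact: mesh_quiver_mut.
by rewrite -mesh_quiver_mut quiver_mutK// => u v; exact: mesh_quiver_2cycle.
Qed.

(** * Evolution of the y-variables *)

Section Seed.
Variables (F : fieldType) (y0 : residue -> F).
Hypothesis reg : regular_seed (mesh_quiver 0, y0) (@row_set p).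

Local Notation seed := (seed_at (mesh_quiver 0, y0) (@row_set p)).

Definition seed_var (r : Z2) : F := (seed (height r)).2 (label r).

Lemma seed_succ t : seed (t + 1) = seed_mut (@row_set p t) (seed t).
Proof.
apply: evolve_succ => n; rewrite -/(seed _).
have sE : (seed (- n%:Z)).1 = mesh_quiver (- n%:Z).
  by rewrite seed_at_quiver quiver_at_mesh.
(* Here regularity concerns the variables already inverted by the backward move; it passes to the
   original ones by [1 + y = y (1 + y^-1)]. *)
have := reg (t := Negz n); rewrite /seed_at evolve_neg -/(seed_at _ _ _).
case: (seed _) sE => q y /= qE yreg.
rewrite /seed_mut /= quiver_mutK; last by move=> u v; rewrite qE; exact: mesh_quiver_2cycle.
congr (_, _); apply: y_mutK => v vt.
have := yreg v vt; rewrite /y_mut asboolT// => -[yv0 yv1].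
have yn0 : y v != 0 by rewrite invr_eq0 in yv0.
split=> //; have -> : 1 + y v = y v * (1 + (y v)^-1) by rewrite mulrDr mulr1 mulfV// addrC.
exact: mulf_neq0.
Qed.

Lemma seed_var_flip r : (seed (height r + 1)).2 (label r) = (seed_var r)^-1.
Proof.
rewrite seed_succ /= /y_mut asboolT//; apply/(row_setP period_gt0); by exists r.
Qed.

Lemma seed_step t s : t < height s < t + height p ->
  (seed (t + 1)).2 (label s) =
  (seed t).2 (label s)
  * ((if height s == t + height x1 then 1 + seed_var (s - x1) else 1) *
     (if height s == t + height x2 then 1 + seed_var (s - x2) else 1))
  * ((if height s == t + height z1 then 1 + (seed_var (s - z1))^-1 else 1) *
     (if height s == t + height z2 then 1 + (seed_var (s - z2))^-1 else 1))^-1.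
Proof.
move=> /andP[ts st].
have ls : lift_to t (label s) = s.
  by rewrite lift_to_label (shift_to_id period_gt0)// /in_window (ltW ts).
have nMs : ~ row_set t (label s).
  by rewrite /row_set/mkset ls => E; rewrite E ltxx in ts.
rewrite seed_succ /= /y_mut asboolF// seed_at_quiver quiver_at_mesh.
have varE (x : Z2) : height s = t + height x -> (seed t).2 (label (s - x)) = seed_var (s - x).
  by move=> E; rewrite /seed_var height_add height_opp E addrK.
congr (_ * _ * _^-1).
  rewrite (@fsbig_row _ _ _ t s x1 x2 _ (fun v => 1 + (seed t).2 v)).
    by congr (_ * _); case: eqP => // /varE ->.
  move=> v vt; rewrite (mesh_quiver_to _ vt) ls /in_x exprD.
  by do 2!case: eqP => _; rewrite ?expr0 ?expr1.
rewrite (@fsbig_row _ _ _ t s z1 z2 _ (fun v => 1 + ((seed t).2 v)^-1)).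
  by congr (_ * _); case: eqP => // /varE ->.
move=> v vt; rewrite (mesh_quiver_from _ vt) ls /in_z exprD.
by do 2!case: eqP => _; rewrite ?expr0 ?expr1.
Qed.

(** Follows the vertex of [s] from just after its mutation as [s - p], where its variable was
    inverted, to its next one as [s]. Each factor enters once its row has been mutated. *)
Lemma seed_var_after s (n : nat) : n%:Z < height p ->
  let t := height s - height p + 1 + n%:Z in
  (seed t).2 (label s) = (seed_var (s - p))^-1
  * ((if height s < t + height x1 then 1 + seed_var (s - x1) else 1) *
     (if height s < t + height x2 then 1 + seed_var (s - x2) else 1))
  * ((if height s < t + height z1 then 1 + (seed_var (s - z1))^-1 else 1) *
     (if height s < t + height z2 then 1 + (seed_var (s - z2))^-1 else 1))^-1.
Proof.
have px : height p = height x1 + height x2 by rewrite -x12.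
have pz : height p = height z1 + height z2 by rewrite -z12.
elim: n => [_|n IH np] t.
  rewrite !ifF ?mulr1 ?invr1 ?mulr1; [|rewrite /t; lia..].
  rewrite -seed_var_flip height_add height_opp /t addr0; congr (snd _ _).
  by apply/label_eqP; exists (-1); rewrite addrAC subrr add0r mulrN1z.
pose t' := height s - height p + 1 + n%:Z.
have -> : t = t' + 1 by rewrite /t /t'; lia.
rewrite seed_step; last by rewrite /t'; lia.
rewrite IH; last by lia.
rewrite -/t'.
have split_if (x : Z2) (k : F) : (if height s < t' + 1 + height x then k else 1) =
   (if height s < t' + height x then k else 1) * (if height s == t' + height x then k else 1).
  have -> : height s < t' + 1 + height x =
      (height s < t' + height x) || (height s == t' + height x) by lia.
  by case: ltgtP; rewrite ?mulr1 ?mul1r.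
have regroup (v A B C D : F) : v * A * B^-1 * C * D^-1 = v * (A * C) * (B * D)^-1.
  by rewrite invfM; ring.
by rewrite regroup !split_if; congr (_ * _ * _^-1); rewrite mulrACA.
Qed.

Lemma seed_var_rel s : seed_var (s - p) * seed_var s =
  (1 + seed_var (s - x1)) * (1 + seed_var (s - x2)) /
  ((1 + (seed_var (s - z1))^-1) * (1 + (seed_var (s - z2))^-1)).
Proof.
have [n nE] : exists n : nat, height p = n.+1%:Z.
  by have := period_gt0; case: (height p) => [[|n]|n] // _; exists n.
(* With [n + 1 = height p] the time is [height s], and all four factors have entered. *)
have := @seed_var_after s n; rewrite nE => /(_ (ltnSn n)); cbv zeta.
have -> : height s - n.+1%:Z + 1 + n%:Z = height s by lia.
rewrite !ltrDl x1_gt0 x2_gt0 z1_gt0 z2_gt0 -/(seed_var s) => ->.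
have [] := reg (t := height (s - p)) (v := label (s - p)).
  by apply/(row_setP period_gt0); exists (s - p).
by rewrite -/(seed_var _) => n0 _; rewrite -[_^-1 * _ * _]mulrA mulVKf.
Qed.

End Seed.
End MeshQuiver.

Theorem theorem1p6 (a b c d : int * int) (pinS : Y_pin a b c d) :
  (forall (R : realType) (D : nat) (P L : int * int -> {vspace 'rV[R]_(D.+1)}),
     (2 <= D)%N -> Y_mesh a b c d P L ->
     Y_relation a b c d (mesh_y a b c d P L)) /\
  (exists (V : choiceType) (Q_S : arrows V) (M : int -> set V)
     (lab : int * int -> V),
     is_quiver Q_S /\ realizes_Y_relation a b c d Q_S M lab).
Proof.
have us := pin_distinct pinS; split=> [R D P L _ meshP|]; first exact: mesh_y_relation meshP us.
have /and3P[ab bc cd] := pin_order pinS.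
have x12 : (d - a) + (c - b) = c + d - a - b by ring.
have z12 : (c - a) + (d - b) = c + d - a - b by ring.
have x1_gt0 : 0 < height (d - a) by rewrite height_add height_opp /height; lia.
have x2_gt0 : 0 < height (c - b) by rewrite height_add height_opp /height; lia.
have z1_gt0 : 0 < height (c - a) by rewrite height_add height_opp /height; lia.
have z2_gt0 : 0 < height (d - b) by rewrite height_add height_opp /height; lia.
(* Each coincidence would force [a = b] or [c = d]. *)
have xz : [&& d - a != c - a, d - a != d - b, c - b != c - a & c - b != d - b].
  move: us; rewrite /= !inE !negb_or -!andbA => /and5P[nab _ _ _ /andP[_ /andP[ncd _]]].
  by rewrite !(inj_eq (addIr _)) !(inj_eq (addrI _)) !eqr_opp [d == c]eq_sym [b == a]eq_sym nab ncd.
pose p := c + d - a - b; pose pgt := period_gt0 x12 x1_gt0 x2_gt0.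
pose q := @mesh_quiver (d - a) (c - b) (c - a) (d - b) p.
exists (residue p), (q 0), (@row_set p), (label pgt); split.
  exact: mesh_quiver_is_quiver.
split.
- by move=> v; exists (lift_to 0 v); exact: lift_toK.
- exact: label_eqP.
- exact: row_setP.
- by move=> t; rewrite quiver_at_mesh//; exact: mesh_quiver_disconnected.
- move=> F y0 reg r.
  (* Based at [s = r + c + d], so that [s - p] is [r + a + b]. *)
  have rel := seed_var_rel x12 z12 x1_gt0 x2_gt0 z1_gt0 z2_gt0 xz reg (r + c + d).
  move: rel; have -> : r + c + d - (c + d - a - b) = r + a + b by ring.
  have -> : r + c + d - (d - a) = r + a + c by ring.
  have -> : r + c + d - (c - b) = r + b + d by ring.
  have -> : r + c + d - (c - a) = r + a + d by ring.
  by have -> : r + c + d - (d - b) = r + b + c by ring.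
Qed.
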